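(* There is a unique sequence of mappings $(\operatorname{dt}_n)_{n\in\mathbb N}$ with the following properties. (i) $\operatorname{dt}_n:H_n(\mathbb H_C)\to\mathbb H_C$ is a continuous mapping for each $n\in\mathbb N$. (ii) If $x=(x_{11})\in H_1(\mathbb H_C)$, then $\operatorname{dt}_1x=x_{11}$. (iii) If $x=(x_{ij})\in H_{n+1}(\mathbb H_C)$ and $x_{11}\neq0$, then $$\operatorname{dt}_{n+1}x=x_{11}\cdot\operatorname{dt}_n\left(x_{ij}-x_{11}^{-1}x_{i1}x_{1j}\right)_{2\le i,j\le n+1}.$$ Moreover, the following assertions hold as well. (iv) The values of $\operatorname{dt}_n$ are complex numbers. (v) $\operatorname{dt}_n(\alpha x)=\alpha^n\operatorname{dt}_nx$ for $x\in H_n(\mathbb H_C)$ and $\alpha\in\mathbb C$. (vi) $\operatorname{dt}_nx=\sum_{\sigma,\pi\in\mathbb S_n}\alpha_{\sigma,\pi}\cdot x_{\sigma(1),\pi(1)}\cdots x_{\sigma(n),\pi(n)}$ for some complex coefficients $\alpha_{\sigma,\pi}$ (not depending on $x\in H_n(\mathbb H_C)$), where $\mathbb S_n$ is the set of all permutations of $\{1,\dots,n\}$. (vii) $\det\widehat{x}=(\operatorname{dt}_nx)^2$ for $x\in H_n(\mathbb H_C)$, where $\det$ is the usual determinant on $M_{2n}(\mathbb C)$. (viii) If $x,y\in H_n(\mathbb H_C)$, then the function $\lambda\mapsto\operatorname{dt}_n(\lambda y+x)$ is a complex polynomial of degree at most $n$ with coefficient $\operatorname{dt}_ny$ at $\lambda^n$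 and coefficient $\operatorname{dt}_nx$ at $\lambda^0$. (ix) If $x\in H_n(\mathbb H_C)$, then each eigenvalue of $\widehat{x}$ has even multiplicity. Moreover, $\operatorname{dt}_nx$ is the product of all eigenvalues of $\widehat{x}$, each one counted with half its multiplicity.
   Context: Biquaternions $\mathbb H_C$ are the associative four-dimensional complex algebra $\mathcal A_2$ from the Cayley–Dickson process: $\mathcal A_0=\mathbb C$ with its usual product and $x^\diamond=x$; $\mathcal A_{n+1}=\mathcal A_n\times\mathcal A_n$ with $(x_1,x_2)^\diamond=(x_1^\diamond,-x_2)$ and $(x_1,x_2)(y_1,y_2)=(x_1y_1-y_2x_2^\diamond,\ x_1^\diamond y_2+y_1x_2)$. Complex numbers are identified with scalar multiples of the unit. There is an algebra isomorphism $x\mapsto\widehat{x}$ of $\mathbb H_C$ onto $M_2(\mathbb C)$: $$(x_1,x_2,x_3,x_4)\mapsto\begin{pmatrix}x_1+ix_2&x_3-ix_4\\-x_3-ix_4&x_1-ix_2\end{pmatrix},$$ under which $^\diamond$ becomes $\begin{pmatrix}a&b\\c&d\end{pmatrix}^\diamond=\begin{pmatrix}d&-b\\-c&a\end{pmatrix}$. For $x=(x_{ij})\in M_n(\mathbb H_C)$, $\widehat x\in M_{2n}(\mathbb C)$ is the block matrix with $2\times2$ blocks $\widehat{x_{ij}}$. For $x\in M_n(\mathbb H_C)$ put $(x^\diamond)_{ij}=(x_{ji})^\diamond$ and let $H_n(\mathbb H_C)=\{x\in M_n(\mathbb H_C):x^\diamond=x\}$. (The diagonal entries of $x\in H_n(\mathbb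 H_C)$ are complex numbers, and the matrix on the right-hand side of (iii) belongs to $H_n(\mathbb H_C)$.) Multiplicity of an eigenvalue means algebraic multiplicity, i.e. as a root of the characteristic polynomial. *)

(* Defs.v *)
From HB Require Import structures.
From mathcomp Require Import all_boot all_order all_algebra perm.
From mathcomp Require Import complex.
From mathcomp Require Import all_classical all_reals topology normedtype.
From mathcomp Require Import ring.

Set Implicit Arguments.
Unset Strict Implicit.
Unset Printing Implicit Defensive.

Import Order.TTheory GRing.Theory Num.Theory.
Import numFieldNormedType.Exports.

Local Open Scope classical_set_scope.
Local Open Scope ring_scope.
Local Open Scope complex_scope.

(* R[i] has no topology in the libraries: give it the one of its modulus. *)
HB.instance Definition _ (R : realType) := PseudoPointedMetric.copy R[i] R[i]^o.

Fixpoint cd (C : comNzRingType) (n : nat) : lmodType C :=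
  if n is m.+1 then (cd C m * cd C m)%type : lmodType C else C^o.

Fixpoint cd_diamond (C : comNzRingType) (n : nat) : cd C n -> cd C n :=
  match n return cd C n -> cd C n with
  | 0 => fun x => x
  | m.+1 => fun x => (cd_diamond x.1, - x.2)
  end.

Fixpoint cd_mul (C : comNzRingType) (n : nat) : cd C n -> cd C n -> cd C n :=
  match n return cd C n -> cd C n -> cd C n with
  | 0 => fun x y : C => x * y
  | m.+1 => fun x y =>
      (cd_mul x.1 y.1 - cd_mul y.2 (cd_diamond x.2),
       cd_mul (cd_diamond x.1) y.2 + cd_mul y.1 x.2)
  end.

Fixpoint cd_one (C : comNzRingType) (n : nat) : cd C n :=
  match n return cd C n with
  | 0 => 1 : C
  | m.+1 => (cd_one C m, 0)
  end.

(* Biquaternions: (x_1, x_2, x_3, x_4) is encoded as ((x_1, x_2), (x_3, x_4)).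
   This is cd R[i] 2 up to conversion. The alias carries the Cayley-Dickson
   product, not the componentwise product of pairs. *)
Definition biquat (R : realType) : Type := ((R[i] * R[i]) * (R[i] * R[i]))%type.

HB.instance Definition _ (R : realType) :=
  GRing.Lmodule.copy (biquat R) (cd R[i] 2).

HB.instance Definition _ (R : realType) :=
  PseudoMetric.copy (biquat R) ((R[i] * R[i]) * (R[i] * R[i]))%type.

Section BiquatAlgebra.
Variable R : realType.
Local Notation C := R[i].
Local Notation H := (biquat R).

Definition bq_mul : H -> H -> H := @cd_mul C 2.
Definition bq_one : H := cd_one C 2.
Definition bq_diamond : H -> H := @cd_diamond C 2.

Lemma bq_eqP (x y : H) : x.1.1 = y.1.1 :> C -> x.1.2 = y.1.2 :> C ->
  x.2.1 = y.2.1 :> C -> x.2.2 = y.2.2 :> C -> x = y.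
Proof.
by case: x y => [[x1 x2] [x3 x4]] [[y1 y2] [y3 y4]] /= -> -> -> ->.
Qed.

Lemma bq_mulA : associative bq_mul.
Proof.
move=> [[x1 x2] [x3 x4]] [[y1 y2] [y3 y4]] [[z1 z2] [z3 z4]].
by apply: bq_eqP => /=; ring.
Qed.

Lemma bq_mul1r : left_id bq_one bq_mul.
Proof. by move=> [[x1 x2] [x3 x4]]; apply: bq_eqP => /=; ring. Qed.

Lemma bq_mulr1 : right_id bq_one bq_mul.
Proof. by move=> [[x1 x2] [x3 x4]]; apply: bq_eqP => /=; ring. Qed.

Lemma bq_mulDl : left_distributive bq_mul +%R.
Proof.
move=> [[x1 x2] [x3 x4]] [[y1 y2] [y3 y4]] [[z1 z2] [z3 z4]].
by apply: bq_eqP => /=; ring.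
Qed.

Lemma bq_mulDr : right_distributive bq_mul +%R.
Proof.
move=> [[x1 x2] [x3 x4]] [[y1 y2] [y3 y4]] [[z1 z2] [z3 z4]].
by apply: bq_eqP => /=; ring.
Qed.

Lemma bq_oner_neq0 : bq_one != 0.
Proof. by apply/eqP => -[] /eqP; rewrite oner_eq0. Qed.

HB.instance Definition _ := GRing.Zmodule_isNzRing.Build H
  bq_mulA bq_mul1r bq_mulr1 bq_mulDl bq_mulDr bq_oner_neq0.

Lemma bq_scalerAl (a : C) (x y : H) : a *: (x * y) = (a *: x : H) * y.
Proof.
case: x y => [[x1 x2] [x3 x4]] [[y1 y2] [y3 y4]].
by apply: bq_eqP; rewrite /= /GRing.scale /=; ring.
Qed.

HB.instance Definition _ := GRing.Lmodule_isLalgebra.Build C H bq_scalerAl.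

Lemma bq_scalerAr (a : C) (x y : H) : a *: (x * y) = x * (a *: y : H).
Proof.
case: x y => [[x1 x2] [x3 x4]] [[y1 y2] [y3 y4]].
by apply: bq_eqP; rewrite /= /GRing.scale /=; ring.
Qed.

HB.instance Definition _ := GRing.Lalgebra_isAlgebra.Build C H bq_scalerAr.

(* The complex number N such that x x^diamond = x^diamond x = N; x is
   invertible exactly when N <> 0. *)
Definition bq_norm (x : H) : C :=
  (x.1.1 : C) ^+ 2 + (x.1.2 : C) ^+ 2 + (x.2.1 : C) ^+ 2 + (x.2.2 : C) ^+ 2.

Definition bq_inv (x : H) : H :=
  if bq_norm x != 0 then (bq_norm x)^-1 *: bq_diamond x else x.

Lemma bq_normM (x y : H) : bq_norm (x * y) = bq_norm x * bq_norm y.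
Proof.
case: x y => [[x1 x2] [x3 x4]] [[y1 y2] [y3 y4]].
by rewrite /bq_norm /=; ring.
Qed.

Lemma bq_mul_diamond (x : H) : x * bq_diamond x = (bq_norm x)%:A.
Proof.
case: x => [[x1 x2] [x3 x4]].
by apply: bq_eqP; rewrite /bq_norm /= /GRing.scale /=; ring.
Qed.

Lemma bq_diamond_mul (x : H) : bq_diamond x * x = (bq_norm x)%:A.
Proof.
case: x => [[x1 x2] [x3 x4]].
by apply: bq_eqP; rewrite /bq_norm /= /GRing.scale /=; ring.
Qed.

Lemma bq_norm1 : bq_norm 1 = 1.
Proof. by rewrite /bq_norm /=; ring. Qed.

Definition bq_unit : pred H := fun x => bq_norm x != 0.

Lemma bq_mulVr : {in bq_unit, left_inverse 1 bq_inv *%R}.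
Proof.
move=> x; rewrite unfold_in => Nx; rewrite /bq_inv Nx -scalerAl bq_diamond_mul.
by rewrite scalerA mulVf // scale1r.
Qed.

Lemma bq_mulrV : {in bq_unit, right_inverse 1 bq_inv *%R}.
Proof.
move=> x; rewrite unfold_in => Nx; rewrite /bq_inv Nx -scalerAr bq_mul_diamond.
by rewrite scalerA mulVf // scale1r.
Qed.

Lemma bq_unitP (x y : H) : y * x = 1 /\ x * y = 1 -> bq_unit x.
Proof.
case=> yx1 _; apply/eqP => Nx0; have := bq_normM y x.
by rewrite yx1 bq_norm1 Nx0 mulr0 => /eqP; rewrite oner_eq0.
Qed.

Lemma bq_inv_out : {in [predC bq_unit], bq_inv =1 id}.
Proof. by move=> x; rewrite inE /= unfold_in /bq_inv => /negbTE ->. Qed.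

HB.instance Definition _ := GRing.NzRing_hasMulInverse.Build H
  bq_mulVr bq_mulrV bq_unitP bq_inv_out.

Definition hat2 (x : H) : 'M[C]_2 :=
  let x1 : C := x.1.1 in let x2 : C := x.1.2 in
  let x3 : C := x.2.1 in let x4 : C := x.2.2 in
  \matrix_(i < 2, j < 2)
    if i == 0 then if j == 0 then x1 + 'i * x2 else x3 - 'i * x4
    else if j == 0 then - x3 - 'i * x4 else x1 - 'i * x2.

(* 'M_(2n), the size 2n being presented as \sum_(i < n) 2 by \mxblock. *)
Definition hat n (x : 'M[H]_n) : 'M[C]_(\sum_(i < n) 2) :=
  \mxblock_(i < n, j < n) hat2 (x i j).

Definition mx_diamond n (x : 'M[H]_n) : 'M[H]_n :=
  \matrix_(i, j) bq_diamond (x j i).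

Definition Hn n : set 'M[H]_n := [set x | mx_diamond x = x].
Arguments Hn n : clear implicits.

(* The right-hand side matrix of the recursion for dt_(n+1). *)
Definition schur n (x : 'M[H]_n.+1) : 'M[H]_n :=
  \matrix_(i, j) (x (lift 0 i) (lift 0 j)
                  - (x 0 0)^-1 * x (lift 0 i) 0 * x 0 (lift 0 j)).

(* dt n stands for dt_(n+1), since the sequence starts with dt_1; only the
   values of dt n on Hn n.+1 are meaningful. *)
Definition is_dt (dt : forall n, 'M[H]_n.+1 -> H) : Prop :=
  [/\ forall n, {within Hn n.+1, continuous (dt n)},
      forall x : 'M[H]_1, Hn 1 x -> dt 0%N x = x 0 0
    & forall n (x : 'M[H]_n.+2), Hn n.+2 x -> x 0 0 != 0 ->
        dt n.+1 x = x 0 0 * dt n (schur x)].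

End BiquatAlgebra.

Arguments Hn R n : clear implicits.

(* Main.v *)
(* If x_11 = s <> 0 then det(hat x) = s^2 det(hat(schur x)), and schur x is
   A - s^-1 v v^diamond, where A is the complementary minor and v the first column
   of x. Suppose dt_n has the form (vi), is complex valued and has square
   det(hat). Then dt_n(A - t v v^diamond) is a polynomial in t whose square at
   t = 1/s, multiplied by s^2, is a polynomial in s, namely det(hat x) as a function
   of the corner entry. Hence it is affine in t, say P_0 - t P_1, and
   dt_(n+1) x = x_11 P_0 - P_1 is again of the form (vi), with square det(hat x).
   For (ix), the characteristic polynomial of hat x is the square of
   dt_n(lambda - x). *)
Require Import Defs.
From HB Require Import structures.
From mathcomp Require Import all_boot all_order all_algebra perm.
From mathcomp Require Import complex.
From mathcomp Require Import all_classical all_reals topology normedtype.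
From mathcomp Require Import ring.

Set Implicit Arguments.
Unset Strict Implicit.
Unset Printing Implicit Defensive.

Import Order.TTheory GRing.Theory Num.Theory.
Import numFieldNormedType.Exports.

Local Open Scope classical_set_scope.
Local Open Scope ring_scope.
Local Open Scope complex_scope.

(** * Products of linear factors over a noncommutative ring *)

Section Lin.
Variable S : nzRingType.

(** ['X] is central in [{poly S}] even when [S] is not commutative, so every coefficient keeps its
    factors in the order of the product. *)
Definition linprod n (a b : 'I_n -> S) : {poly S} :=
  \prod_(k < n) ((a k)%:P + (b k)%:P * 'X).

Lemma linprod_recl n (a b : 'I_n.+1 -> S) (i : nat) :
  (linprod a b)`_i = a ord0 * (linprod (a \o lift ord0) (b \o lift ord0))`_i
  + (if i is i'.+1
     then b ord0 * (linprod (a \o lift ord0) (b \o lift ord0))`_i' else 0).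
Proof.
rewrite /linprod big_ord_recl mulrDl coefD coefCM -mulrA coefCM coefXM.
by case: i => [|i] //=; rewrite mulr0.
Qed.

Lemma size_linprod n (a b : 'I_n -> S) : (size (linprod a b) <= n.+1)%N.
Proof.
elim: n a b => [|n IH] a b; first by rewrite /linprod big_ord0 size_poly1.
apply/leq_sizeP => -[//|i] ni; rewrite linprod_recl.
by rewrite !(leq_sizeP _ _ (IH _ _)) ?mulr0 ?addr0 // ltnW.
Qed.

Lemma linprod_coef0 n (a b : 'I_n -> S) : (linprod a b)`_0 = \prod_(k < n) a k.
Proof.
elim: n a b => [|n IH] a b; first by rewrite /linprod !big_ord0 coef1.
by rewrite linprod_recl IH addr0 big_ord_recl.
Qed.

Lemma linprod_coefn n (a b : 'I_n -> S) : (linprod a b)`_n = \prod_(k < n) b k.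
Proof.
elim: n a b => [|n IH] a b; first by rewrite /linprod !big_ord0 coef1.
rewrite linprod_recl IH big_ord_recl (leq_sizeP _ _ (size_linprod _ _)) //.
by rewrite mulr0 add0r.
Qed.

Lemma linprod_coef1 n (a b : 'I_n -> S) :
  (linprod a b)`_1 = \sum_(j < n) \prod_(k < n) (if k == j then b k else a k).
Proof.
elim: n a b => [|n IH] a b; first by rewrite /linprod !big_ord0 coef1.
rewrite linprod_recl IH linprod_coef0 [RHS]big_ord_recl addrC; congr (_ + _).
  by rewrite big_ord_recl eqxx; congr (_ * _); apply: eq_bigr => k _.
rewrite mulr_sumr; apply: eq_bigr => j _; rewrite big_ord_recl /=; congr (_ * _).
Qed.

(** Evaluation is multiplicative at central points; the lemma is applied at complex scalars of
    [H]. *)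
Lemma horner_linprod n (a b : 'I_n -> S) (c : S) : (forall x, GRing.comm c x) ->
  (linprod a b).[c] = \prod_(k < n) (a k + b k * c).
Proof.
move=> cc; elim: n a b => [|n IH] a b; first by rewrite /linprod !big_ord0 hornerC.
rewrite /linprod big_ord_recl hornerM_comm; last exact: cc.
by rewrite -/(linprod _ _) IH big_ord_recl hornerD hornerCM hornerC hornerX.
Qed.

(* [G] is [F] with the consecutive factors of indices [j] and [j.+1] merged. *)
Lemma prod_merge n (F : 'I_n.+1 -> S) (G : 'I_n -> S) (j : 'I_n) :
  (forall k : 'I_n, (k < j)%N -> G k = F (widen_ord (leqnSn n) k)) ->
  G j = F (widen_ord (leqnSn n) j) * F (lift ord0 j) ->
  (forall k : 'I_n, (j < k)%N -> G k = F (lift ord0 k)) ->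
  \prod_(k < n) G k = \prod_(k < n.+1) F k.
Proof.
have w0 m : widen_ord (leqnSn m.+1) ord0 = ord0 by apply: val_inj.
have wl m (k : 'I_m) : widen_ord (leqnSn m.+1) (lift ord0 k)
    = lift ord0 (widen_ord (leqnSn m) k) by apply: val_inj.
elim: n F G j => [|n IH] F G j; first by case: j.
move=> lo mid hi; rewrite big_ord_recl [RHS]big_ord_recl.
case: (unliftP ord0 j) => [j'|] ej; subst j.
  rewrite lo // w0; congr (_ * _); apply: (IH _ _ j') => [k kj||k kj].
  - by rewrite lo // wl.
  - by rewrite mid wl.
  - by rewrite hi.
rewrite mid w0 -mulrA [X in _ = _ * X]big_ord_recl; congr (_ * (_ * _)).
by apply: eq_bigr => k _; rewrite hi.
Qed.

End Lin.

(** * Polynomial identities over a field of characteristic 0 *)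

Section FieldPoly.
Variable F : numFieldType.

(** In characteristic 0 the elements 1, 2, 3, ... are distinct and nonzero, which gives [p - q] more
    roots than its degree allows. *)
Lemma poly_eq_nonzero (p q : {poly F}) :
  (forall s, s != 0 -> p.[s] = q.[s]) -> p = q.
Proof.
move=> pq; apply/eqP; rewrite -subr_eq0; apply/negPn/negP => d0.
have := max_poly_roots (rs := [seq k.+1%:R | k <- iota 0 (size (p - q))]) d0.
rewrite size_map size_iota ltnn => h; apply: notF; apply: h.
  apply/allP => _ /mapP[k _ ->]; rewrite /root hornerD hornerN pq ?subrr //.
  by rewrite pnatr_eq0.
by rewrite map_inj_uniq ?iota_uniq // => i j /eqP; rewrite eqr_nat => /eqP[].
Qed.

(* Clearing denominators in [q.[s]] gives [r ^+ 2 = 'X^(2m + 2) * q] for the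
   reversed polynomial [r] of [p], of size [m.+3]; but [r.[0]] is, up to sign,
   the leading coefficient of [p]. *)
Lemma poly_inv_square (p q : {poly F}) :
  (forall s, s != 0 -> q.[s] = s ^+ 2 * p.[- s^-1] ^+ 2) ->
  (size p <= 2)%N /\ forall s, q.[s] = (s * p`_0 - p`_1) ^+ 2.
Proof.
move=> qp; have sp : (size p <= 2)%N.
  rewrite leqNgt; apply/negP => p3.
  have [m em] : exists m, size p = m.+3.
    by case: (size p) p3 => [|[|[|m]]] // _; exists m.
  pose r := \sum_(i < m.+3) (p`_i * (-1) ^+ i) *: 'X^(m.+2 - i).
  have rE s : s != 0 -> r.[s] = s ^+ m.+2 * p.[- s^-1].
    move=> s0; rewrite horner_sum horner_coef em mulr_sumr; apply: eq_bigr => i _.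
    have im : (i <= m.+2)%N by rewrite -ltnS.
    have -> : s ^+ m.+2 = s ^+ (m.+2 - i) * s ^+ i by rewrite -exprD subnK.
    rewrite hornerZ hornerXn [(- s^-1) ^+ _]exprNn exprVn.
    by rewrite mulrAC mulrACA; field; rewrite expf_neq0.
  have r2 : r ^+ 2 = 'X ^+ (m.+1 + m.+1) * q.
    apply: poly_eq_nonzero => s s0; rewrite horner_exp hornerM hornerXn rE // qp //.
    rewrite mulrA -exprD exprMn -exprM; congr (_ ^+ _ * _).
    by rewrite muln2 -addnn -addSnnS !addnS addn0.
  have := congr1 (fun u => u.[0]) r2.
  rewrite horner_exp hornerM hornerXn expr0n mul0r => /eqP.
  rewrite expf_eq0 /= horner_sum big_ord_recr /= subnn expr0 hornerZ hornerC mulr1.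
  rewrite big1 ?add0r; last first.
    move=> i _; rewrite hornerZ hornerXn expr0n subn_eq0 leqNgt.
    by rewrite ltnS -ltnS ltn_ord /= mulr0.
  rewrite mulf_eq0 signr_eq0 orbF => pm.
  by have := lead_coef_eq0 p; rewrite /lead_coef em /= pm -size_poly_eq0 em.
split=> // s.
(* For affine [p] and [s != 0], [s * p.[- s^-1]] is [s * p_0 - p_1]; an equality of polynomials
   carries this over to [s = 0]. *)
suff -> : q = (p`_0 *: 'X - (p`_1)%:P) ^+ 2.
  by rewrite horner_exp hornerD hornerN hornerC hornerZ hornerX mulrC.
apply: poly_eq_nonzero => t t0; rewrite qp // -exprMn horner_exp; congr (_ ^+ 2).
rewrite (horner_coef_wide _ sp) !big_ord_recl big_ord0 /= addr0 expr0 expr1 mulr1.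
rewrite hornerD hornerN hornerC hornerZ hornerX mulrDr !mulrN mulrCA mulfV //.
by rewrite mulr1 [t * _]mulrC.
Qed.

Lemma det_pencil_poly n (A B : 'M[F]_n) :
  exists q : {poly F}, forall s, q.[s] = \det (A + s *: B).
Proof.
exists (\det (map_mx polyC A + 'X *: map_mx polyC B)) => s.
rewrite -horner_evalE -det_map_mx; congr (\det _); apply/matrixP => i j.
by rewrite !mxE /= /horner_eval hornerD hornerC hornerM hornerX hornerC.
Qed.

End FieldPoly.

(** * Complex scalars and polynomials over the biquaternions *)

Section Biquat.
Variable R : realType.
Local Notation C := R[i].
Local Notation H := (biquat R).

Lemma scalar_comm (c : C) (x : H) : GRing.comm (c%:A : H) x.
Proof. by rewrite /GRing.comm mulr_algl mulr_algr. Qed.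

(** By linearity of [phi], the map sending [c] to [phi p.[c%:A]] is the complex polynomial with
    coefficients [phi p_i], and it vanishes away from 0. *)
Lemma horner_additive_eq0 (phi : H -> C) (p : {poly H}) :
  {morph phi : x y / x + y} -> (forall c x, phi (c *: x) = c * phi x) ->
  (forall c, c != 0 -> phi p.[c%:A] = 0) -> forall i, phi p`_i = 0.
Proof.
move=> phiD phiZ p0 i.
have phi0 : phi 0 = 0 by rewrite -[0 in LHS](scale0r (0 : H)) phiZ mul0r.
have q0 : \poly_(i < size p) phi p`_i = 0.
  apply: poly_eq_nonzero => s s0; rewrite horner0 horner_poly.
  rewrite -[RHS](p0 s s0) horner_coef.
  rewrite (big_morph phi phiD phi0); apply: eq_bigr => k _.
  have -> : (s%:A : H) ^+ k = (s ^+ k)%:A.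
    by rewrite -[LHS]/(in_alg H s ^+ k) -rmorphXn.
  by rewrite mulr_algr phiZ mulrC.
have := congr1 (fun q : {poly C} => q`_i) q0; rewrite coef_poly coef0.
by case: ltnP => // si _; rewrite nth_default.
Qed.

Lemma biquat_scalarE (c : C) : c%:A = ((c, 0), (0, 0)) :> H.
Proof. by apply: bq_eqP; rewrite /GRing.scale /= /GRing.scale /= ?mulr0 ?mulr1. Qed.

(** The three nonscalar coordinates are linear and vanish on scalars, so [horner_additive_eq0] kills
    them in each coefficient. *)
Lemma scalar_valued_poly (p : {poly H}) :
  (forall c : C, c != 0 -> exists d : C, p.[c%:A] = d%:A) ->
  exists q : {poly C}, p = map_poly (in_alg H) q.
Proof.
move=> pd; exists (\poly_(i < size p) (p`_i).1.1); apply/polyP => i.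
have h (phi : H -> C) : {morph phi : x y / x + y} ->
    (forall c x, phi (c *: x) = c * phi x) -> phi 1 = 0 -> phi p`_i = 0.
  move=> phiD phiZ phi1; apply: horner_additive_eq0 => // c /pd[d ->].
  by rewrite phiZ phi1 mulr0.
rewrite coef_map coef_poly; case: ltnP => [_|si]; last first.
  by rewrite nth_default //= scale0r.
rewrite /= biquat_scalarE; apply: bq_eqP => //=.
- exact: (h (fun x : H => x.1.2)).
- exact: (h (fun x : H => x.2.1)).
- exact: (h (fun x : H => x.2.2)).
Qed.

Lemma horner_map_alg (q : {poly C}) (c : C) :
  (map_poly (in_alg H) q).[c%:A] = q.[c]%:A.
Proof. exact: (horner_map (in_alg H) q c). Qed.

(** * Sums of the form (vi) and their restriction to lines *)

Definition mdet n (a : 'S_n -> 'S_n -> C) (x : 'M[H]_n) : H :=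
  \sum_(s : 'S_n) \sum_(t : 'S_n) a s t *: \prod_(k < n) x (s k) (t k).

Definition pencil n (a : 'S_n -> 'S_n -> C) (x y : 'M[H]_n) : {poly H} :=
  \sum_(s : 'S_n) \sum_(t : 'S_n) ((a s t)%:A : H) *:
    linprod (fun k => x (s k) (t k)) (fun k => y (s k) (t k)).

Lemma size_pencil n (a : 'S_n -> 'S_n -> C) x y : (size (pencil a x y) <= n.+1)%N.
Proof.
do 2!(apply: (leq_trans (size_sum _ _ _)); apply/bigmax_leqP => ? _).
exact: (leq_trans (size_scale_leq _ _) (size_linprod _ _)).
Qed.

Lemma pencil_coef n (a : 'S_n -> 'S_n -> C) x y i : (pencil a x y)`_i =
  \sum_(s : 'S_n) \sum_(t : 'S_n) a s t *:
    (linprod (fun k => x (s k) (t k)) (fun k => y (s k) (t k)))`_i.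
Proof.
rewrite coef_sum; apply: eq_bigr => s _; rewrite coef_sum; apply: eq_bigr => t _.
by rewrite coefZ mulr_algl.
Qed.

Lemma pencil_coef0 n (a : 'S_n -> 'S_n -> C) x y : (pencil a x y)`_0 = mdet a x.
Proof.
rewrite pencil_coef; apply: eq_bigr => s _; apply: eq_bigr => t _.
by rewrite linprod_coef0.
Qed.

Lemma pencil_coefn n (a : 'S_n -> 'S_n -> C) x y : (pencil a x y)`_n = mdet a y.
Proof.
rewrite pencil_coef; apply: eq_bigr => s _; apply: eq_bigr => t _.
by rewrite linprod_coefn.
Qed.

Lemma horner_pencil n (a : 'S_n -> 'S_n -> C) x y (c : C) :
  (pencil a x y).[c%:A] = mdet a (x + (c%:A : H) *: y).
Proof.
rewrite /pencil horner_sum; apply: eq_bigr => s _.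
rewrite horner_sum; apply: eq_bigr => t _; rewrite hornerZ mulr_algl.
rewrite horner_linprod; last by move=> z; exact: scalar_comm.
by congr (_ *: _); apply: eq_bigr => k _; rewrite !mxE scalar_comm.
Qed.

Lemma mdet_sum n (I : finType) (a : I -> 'S_n -> 'S_n -> C) x :
  mdet (fun s t => \sum_i a i s t) x = \sum_i mdet (a i) x.
Proof.
rewrite /mdet [RHS]exchange_big; apply: eq_bigr => s _; rewrite [RHS]exchange_big.
by apply: eq_bigr => t _; rewrite scaler_suml.
Qed.

(** A family supported on one pair of permutations, so that a coefficient family can be assembled
    monomial by monomial. *)
Definition pair_coef n (s0 t0 : 'S_n) (c : C) (s t : 'S_n) : C :=
  if (s == s0) && (t == t0) then c else 0.

Lemma mdet_pair n (s0 t0 : 'S_n) x (c : C) :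
  mdet (pair_coef s0 t0 c) x = c *: \prod_(k < n) x (s0 k) (t0 k).
Proof.
rewrite /mdet /pair_coef (bigD1 s0) //= [X in _ + X]big1 => [|s /negPf->]; last first.
  by rewrite big1 // => t _; rewrite scale0r.
rewrite addr0 (bigD1 t0) //= [X in _ + X]big1 => [|t /negPf->]; last first.
  by rewrite andbF scale0r.
by rewrite !eqxx addr0.
Qed.

(** * The complex representation and its Schur complements *)

Lemma hat2_line (x y : H) (l : C) : hat2 (x + (l%:A : H) * y) = hat2 x + l *: hat2 y.
Proof.
rewrite mulr_algl; case: x y => [[x1 x2] [x3 x4]] [[y1 y2] [y3 y4]].
apply/matrixP => i j; rewrite !mxE /= /GRing.scale /= /GRing.scale /=.
by case: ifP => _; case: ifP => _; ring.
Qed.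

Lemma hatE n (x : 'M[H]_n) i j :
  hat x i j =
  hat2 (x (tagnat.sig1 i) (tagnat.sig1 j)) (tagnat.sig2 i) (tagnat.sig2 j).
Proof. by rewrite /hat mxE. Qed.

Lemma hat_line n (x y : 'M[H]_n) (l : C) :
  hat (x + (l%:A : H) *: y) = hat x + l *: hat y.
Proof.
apply/matrixP => i j; rewrite [RHS]mxE [(l *: hat y) i j]mxE !hatE.
have -> k k' : (x + (l%:A : H) *: y) k k' = x k k' + (l%:A : H) * y k k'.
  by rewrite !mxE.
by rewrite hat2_line; move: (hat2 _) (hat2 _) => A B; rewrite !mxE.
Qed.

Lemma hat2M (x y : H) : hat2 (x * y) = hat2 x *m hat2 y.
Proof.
have i2 : 'i * 'i = -1 :> C by rewrite -expr2 sqr_i.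
case: x y => [[x1 x2] [x3 x4]] [[y1 y2] [y3 y4]].
apply/matrixP => i j; rewrite !mxE !big_ord_recl big_ord0 !mxE /=.
case: i => -[|[|//]] /= _; case: j => -[|[|//]] /= _.
all: by ring: i2.
Qed.

Lemma hat2_scalar (c : C) : hat2 c%:A = c%:M.
Proof.
rewrite biquat_scalarE; apply/matrixP => i j; rewrite !mxE /=.
case: i => -[|[|//]] ?; case: j => -[|[|//]] ? /=;
  by rewrite ?mulr0 ?subr0 ?addr0 ?oppr0.
Qed.

Lemma hat_scalar n (c : C) : hat ((c%:A : H)%:M : 'M_n) = c%:M.
Proof.
rewrite -mxdiagZ /mxdiag; apply: eq_mxblock => i j; rewrite mxE.
case: eqVneq => [_|_]; first by rewrite mulr1n hat2_scalar conform_mx_id.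
by rewrite mulr0n -(scale0r (1 : H)) hat2_scalar raddf0.
Qed.

(** On [Hn] this is [v v^diamond], with [v] the first column of [x] below the corner. *)
Definition outer00 n (x : 'M[H]_n.+1) : 'M[H]_n :=
  \matrix_(i, j) (x (lift 0 i) 0 * x 0 (lift 0 j)).

Lemma schur_line n (x : 'M[H]_n.+1) (s : C) : x 0 0 = s%:A -> s != 0 ->
  schur x = row' 0 (col' 0 x) + ((- s^-1)%:A : H) *: outer00 x.
Proof.
move=> x00 s0; apply/matrixP => i j; rewrite !mxE x00.
have -> : (s%:A : H)^-1 = s^-1%:A.
  by rewrite -[LHS]/((in_alg H s)^-1) -rmorphV // unitfE.
by rewrite scaleNr mulNr mulrA.
Qed.

Lemma det_castmx_sq (F : comNzRingType) m n (e : m = n) (A : 'M[F]_m) :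
  \det (castmx (e, e) A) = \det A.
Proof. by case: n / e; rewrite castmx_id. Qed.

Lemma hat_block n (x : 'M[H]_n.+1) : hat x = castmx (mxsize_recl, mxsize_recl)
  (block_mx (hat2 (x 0 0)) (\mxrow_j hat2 (x 0 (lift 0 j)))
    (\mxcol_i hat2 (x (lift 0 i) 0)) (hat (row' 0 (col' 0 x)))).
Proof.
rewrite /hat mxblock_recul; congr (castmx _ (block_mx _ _ _ _)).
by apply: eq_mxblock => i j; rewrite !mxE.
Qed.

(** Block elimination with pivot [s%:M] of size 2, whose determinant is [s ^+ 2]. As [hat2] is
    multiplicative, the complementary block that remains is [hat (schur x)]. *)
Lemma det_hat_schur n (x : 'M[H]_n.+1) (s : C) : x 0 0 = s%:A -> s != 0 ->
  \det (hat x) = s ^+ 2 * \det (hat (schur x)).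
Proof.
move=> x00 s0; rewrite hat_block det_castmx_sq x00 hat2_scalar (schur_line x00 s0).
set B := \mxrow_j _; set D := \mxcol_i _; set A := hat (row' _ _).
rewrite hat_line -/A.
have -> : hat (outer00 x) = D *m B.
  rewrite mul_mxcol_mxrow; apply: eq_mxblock => i j; by rewrite mxE hat2M.
have -> : block_mx s%:M B D A = block_mx 1%:M 0 (s^-1 *: D) 1%:M
    *m block_mx s%:M B 0 (A + (- s^-1) *: (D *m B)).
  rewrite mulmx_block !mul1mx !mul0mx ?addr0 mul_mx_scalar scalerA mulfV // scale1r.
  by rewrite -scalemxAl scaleNr addrCA subrr addr0.
by rewrite det_mulmx det_lblock det_ublock !det1 det_scalar !mul1r.
Qed.

Lemma mdetD n (a b : 'S_n -> 'S_n -> C) x :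
  mdet (fun s t => a s t + b s t) x = mdet a x + mdet b x.
Proof.
rewrite /mdet -big_split; apply: eq_bigr => s _; rewrite -big_split.
by apply: eq_bigr => t _; rewrite scalerDl.
Qed.

(* Coefficients of [x 0 0 * P_0 - P_1], where [P] is the pencil of the minor and
   of [outer00 x]: in [P_0] the factor [x 0 0] is put in front; in [P_1] the
   [j]-th factor is a product [x _ 0 * x 0 _], so the index 0 is inserted at
   position [j.+1] among the row indices and [j] among the column indices. *)
Definition mdet_next n (a : 'S_n -> 'S_n -> C) (s t : 'S_n.+1) : C :=
  \sum_(u : 'S_n * 'S_n)
    pair_coef (lift_perm 0 0 u.1) (lift_perm 0 0 u.2) (a u.1 u.2) s t
  + \sum_(u : 'S_n * 'S_n) \sum_(j < n)
    pair_coef (lift_perm (lift 0 j) 0 u.1)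
      (lift_perm (widen_ord (leqnSn n) j) 0 u.2) (- a u.1 u.2) s t.

Lemma mdet_nextE n (a : 'S_n -> 'S_n -> C) (x : 'M[H]_n.+1) :
  mdet (mdet_next a) x = x 0 0 * (pencil a (row' 0 (col' 0 x)) (outer00 x))`_0
    - (pencil a (row' 0 (col' 0 x)) (outer00 x))`_1.
Proof.
rewrite mdetD !mdet_sum; congr (_ + _).
  rewrite pencil_coef0 [in RHS]/mdet [X in _ = _ * X]pair_bigA mulr_sumr.
  apply: eq_bigr => -[s t] _ /=; rewrite mdet_pair big_ord_recl.
  rewrite !lift_perm_id scalerAr; congr (_ * (_ *: _)).
  by apply: eq_bigr => k _; rewrite !lift_perm_lift !mxE.
rewrite pencil_coef [X in _ = - X]pair_bigA -sumrN; apply: eq_bigr => -[s t] _ /=.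
rewrite mdet_sum linprod_coef1 scaler_sumr -sumrN; apply: eq_bigr => j _.
rewrite mdet_pair scaleNr; congr (- (_ *: _)).
set S := lift_perm _ _ s; set T := lift_perm _ _ t.
pose w := widen_ord (leqnSn n).
(* Positions below [j] keep their number and those above move up by one, for [S] and [T] alike; the
   two differ only at [j] and [j.+1]. *)
have lo (k : 'I_n) : (k < j)%N -> S (w k) = lift 0 (s k) /\ T (w k) = lift 0 (t k).
  move=> kj; split.
    rewrite (_ : w k = lift (lift 0 j) k) ?lift_perm_lift //.
    by apply: val_inj; rewrite /= /bump /= leqNgt ltnS ltnW.
  rewrite (_ : w k = lift (w j) k) ?lift_perm_lift //.
  by apply: val_inj; rewrite /= /bump /= leqNgt kj.
have hi (k : 'I_n) : (j < k)%N ->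
    S (lift 0 k) = lift 0 (s k) /\ T (lift 0 k) = lift 0 (t k).
  move=> jk; split.
    rewrite (_ : lift 0 k = lift (lift 0 j) k) ?lift_perm_lift //.
    by apply: val_inj; rewrite /= /bump /= jk.
  rewrite (_ : lift 0 k = lift (w j) k) ?lift_perm_lift //.
  by apply: val_inj; rewrite /= /bump /= ltnW.
(* The factors at [j] and [j.+1] are [x (lift 0 (s j)) 0] and [x 0 (lift 0 (t j))]; they merge into
   an entry of [outer00 x]. *)
have Sj : S (w j) = lift 0 (s j).
  rewrite (_ : w j = lift (lift 0 j) j) ?lift_perm_lift //.
  by apply: val_inj; rewrite /= /bump /= ltnn.
have Tj : T (lift 0 j) = lift 0 (t j).
  rewrite (_ : lift 0 j = lift (w j) j) ?lift_perm_lift //.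
  by apply: val_inj; rewrite /= /bump /= leqnn.
symmetry; apply: (@prod_merge H n (fun k => x (S k) (T k)) _ j) => [k kj||k jk] /=.
- by have [-> ->] := lo k kj; rewrite ifN ?mxE // neq_ltn kj.
- by rewrite eqxx -/w Sj Tj !lift_perm_id mxE.
- by have [-> ->] := hi k jk; rewrite ifN ?mxE // neq_ltn jk orbT.
Qed.

(** * Matrices fixed by the conjugate transpose *)

Lemma HnP n (x : 'M[H]_n) :
  Hn R n x <-> forall i j, bq_diamond (x j i) = x i j.
Proof.
split=> [hx i j|hx]; last by apply/matrixP => i j; rewrite mxE.
by have := congr1 (fun z : 'M[H]_n => z i j) hx; rewrite mxE.
Qed.

Lemma Hn_line n (x y : 'M[H]_n) (l : C) : Hn R n x -> Hn R n y ->
  Hn R n (x + (l%:A : H) *: y).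
Proof.
move=> /HnP hx /HnP hy; apply/HnP => i j.
rewrite !mxE !mulr_algl -hx -hy.
case: (x j i) (y j i) => [[x1 x2] [x3 x4]] [[y1 y2] [y3 y4]].
by apply: bq_eqP; rewrite /= /GRing.scale /=; ring.
Qed.

(** Conjugation negates the last three coordinates, and [- z = z] forces [z = 0]. *)
Lemma bq_diamond_fixed (x : H) : bq_diamond x = x -> x = x.1.1%:A.
Proof.
have N0 (z : C) : - z = z -> z = 0 by move/eqP; rewrite eqNr => /eqP.
case: x => [[x1 x2] [x3 x4]] [/N0 -> /N0 -> /N0 ->].
by rewrite biquat_scalarE.
Qed.

Lemma bq_diamondM (x y : H) : bq_diamond (x * y) = bq_diamond y * bq_diamond x.
Proof.
case: x y => [[x1 x2] [x3 x4]] [[y1 y2] [y3 y4]].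
by apply: bq_eqP; rewrite /=; ring.
Qed.

Lemma bq_diamond_scalar (c : C) : bq_diamond c%:A = c%:A :> H.
Proof. by rewrite biquat_scalarE; apply: bq_eqP; rewrite /= ?oppr0. Qed.

Lemma Hn_scalar n (c : C) : Hn R n (c%:A : H)%:M.
Proof.
apply/HnP => i j; rewrite !mxE eq_sym.
by case: eqP => _; rewrite ?mulr1n ?mulr0n -?(scale0r (1 : H)) bq_diamond_scalar.
Qed.

(** Adding scalar multiples of this matrix moves the corner entry without leaving [Hn]. *)
Lemma Hn_delta n : Hn R n.+1 (delta_mx 0 0).
Proof.
apply/HnP => i j; rewrite !mxE andbC -scaler_nat.
exact: bq_diamond_scalar.
Qed.

Lemma Hn_diag n (x : 'M[H]_n) i : Hn R n x -> exists c : C, x i i = c%:A.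
Proof.
by move=> /HnP/(_ i i)/bq_diamond_fixed ->; exists (x i i).1.1.
Qed.

Lemma Hn_minor n (x : 'M[H]_n.+1) : Hn R n.+1 x -> Hn R n (row' 0 (col' 0 x)).
Proof. by move=> /HnP hx; apply/HnP => i j; rewrite !mxE hx. Qed.

Lemma Hn_outer n (x : 'M[H]_n.+1) : Hn R n.+1 x -> Hn R n (outer00 x).
Proof. by move=> /HnP hx; apply/HnP => i j; rewrite !mxE bq_diamondM !hx. Qed.

Lemma Hn_schur n (x : 'M[H]_n.+1) : Hn R n.+1 x -> x 0 0 != 0 -> Hn R n (schur x).
Proof.
move=> hx; have [c xc] := Hn_diag 0 hx; rewrite xc => c0.
rewrite (schur_line xc); last by apply: contraNneq c0 => ->; rewrite scale0r.
exact: Hn_line (Hn_minor hx) (Hn_outer hx).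
Qed.

(** * The inductive invariant and its passage to the next size *)

Definition moore_form n (a : 'S_n -> 'S_n -> C) : Prop :=
  forall x, Hn R n x -> exists c : C, mdet a x = c%:A /\ \det (hat x) = c ^+ 2.

(* With the corner entry of [x] replaced by [s <> 0], the determinant of [hat x] is
   [s ^+ 2 * q.[- s^-1] ^+ 2] and also a polynomial in [s]; this forces
   [size q <= 2]. *)
Lemma moore_form_schur_pencil n (a : 'S_n -> 'S_n -> C) (x : 'M[H]_n.+1) (s : C) :
  moore_form a -> Hn R n.+1 x -> x 0 0 = s%:A ->
  exists q : {poly C},
    [/\ pencil a (row' 0 (col' 0 x)) (outer00 x) = map_poly (in_alg H) q,
        (size q <= 2)%N & \det (hat x) = (s * q`_0 - q`_1) ^+ 2].
Proof.
move=> ga hx x00; set P := pencil _ _ _.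
pose E : 'M[H]_n.+1 := delta_mx 0 0.
pose X (t : C) := x + ((t - s)%:A : H) *: E.
have HX t : Hn R n.+1 (X t) by apply: Hn_line => //; exact: Hn_delta.
have X00 t : X t 0 0 = t%:A by rewrite !mxE x00 !eqxx mulr1 -scalerDl addrC subrK.
have Xrow t : row' 0 (col' 0 (X t)) = row' 0 (col' 0 x).
  by apply/matrixP => i j; rewrite !mxE mulr0 addr0.
have Xout t : outer00 (X t) = outer00 x.
  by apply/matrixP => i j; rewrite !mxE /= !mulr0 !addr0.
have schurX t : t != 0 -> mdet a (schur (X t)) = P.[(- t^-1)%:A].
  by move=> t0; rewrite (schur_line (X00 t) t0) Xrow Xout -horner_pencil.
have HsX t : t != 0 -> Hn R n (schur (X t)).
  move=> t0; apply: Hn_schur (HX t) _; rewrite X00.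
  by rewrite scaler_eq0 (negPf t0) oner_eq0.
have [q Pq] : exists q : {poly C}, P = map_poly (in_alg H) q.
  apply: scalar_valued_poly => c c0.
  (* For [t = - c^-1] one has [c = - t^-1], so [P] at [c] is the value of the form on [schur (X t)],
     a scalar by the invariant. *)
  have t0 : - c^-1 != 0 by rewrite oppr_eq0 invr_eq0.
  have [d [dE _]] := ga _ (HsX _ t0).
  by exists d; rewrite -dE schurX // invrN opprK invrK.
have [r rE] := det_pencil_poly (hat (X 0)) (hat E).
have rX t : r.[t] = \det (hat (X t)).
  suff -> : X t = X 0 + (t%:A : H) *: E by rewrite hat_line.
  have e : (t - s)%:A = (0 - s)%:A + t%:A :> H by rewrite -scalerDl sub0r addrC.
  by rewrite {1}/X e scalerDl addrA.
have [] := @poly_inv_square _ q r.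
  move=> t t0; rewrite rX (det_hat_schur (X00 t) t0); congr (_ * _).
  have [d [dE ->]] := ga _ (HsX _ t0); congr (_ ^+ 2).
  move: dE; rewrite schurX // Pq horner_map_alg => /eqP.
  by rewrite -subr_eq0 -scalerBl scaler_eq0 oner_eq0 orbF subr_eq0 => /eqP ->.
move=> sq qE; exists q; split=> //.
(* Evaluation at the original corner entry [s], where [X s = x]; [s] may be 0. *)
by rewrite -qE rX /X subrr scale0r scale0r addr0.
Qed.

Lemma moore_form_next n (a : 'S_n -> 'S_n -> C) :
  moore_form a -> moore_form (mdet_next a).
Proof.
move=> ga x hx; have [s x00] := Hn_diag 0 hx.
have [q [Pq _ ->]] := moore_form_schur_pencil ga hx x00.
exists (s * q`_0 - q`_1); split=> //.
by rewrite mdet_nextE Pq !coef_map /= x00 mulr_algl scalerA -scalerBl.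
Qed.

(** Affinity of [q] gives [s * q.[- s^-1] = s * q_0 - q_1]: the left side comes from the recursion
    (iii), the right side from [mdet_nextE]. *)
Lemma mdet_next_schur n (a : 'S_n -> 'S_n -> C) (x : 'M[H]_n.+1) :
  moore_form a -> Hn R n.+1 x -> x 0 0 != 0 ->
  mdet (mdet_next a) x = x 0 0 * mdet a (schur x).
Proof.
move=> ga hx x00n; have [s x00] := Hn_diag 0 hx.
have s0 : s != 0 by apply: contraNneq x00n => s0; rewrite x00 s0 scale0r.
have [q [Pq sq _]] := moore_form_schur_pencil ga hx x00.
rewrite mdet_nextE (schur_line x00 s0) -horner_pencil Pq !coef_map horner_map_alg /=.
rewrite x00 !mulr_algl !scalerA -scalerBl; congr (_ *: _).
rewrite (horner_coef_wide _ sq) !big_ord_recl big_ord0 /= addr0 expr0 expr1 mulr1.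
by rewrite mulrDr !mulrN mulrCA mulfV // mulr1.
Qed.

(** The recursion starts with the empty matrix, one size before [dt_1], where the form takes the
    value 1. *)
Fixpoint moore_coef n : 'S_n -> 'S_n -> C :=
  if n is m.+1 then mdet_next (@moore_coef m) else fun _ _ => 1.

Lemma mdet_moore0 (x : 'M[H]_0) : mdet (@moore_coef 0) x = 1.
Proof.
rewrite /mdet /= (bigD1 (1%g : 'S_0)) //= [X in _ + X]big1 ?addr0; last first.
  by move=> s /eqP[]; apply/permP => -[].
rewrite (bigD1 (1%g : 'S_0)) //= [X in _ + X]big1 ?addr0; last first.
  by move=> s /eqP[]; apply/permP => -[].
by rewrite big_ord0 scale1r.
Qed.

Lemma moore_coefP n : moore_form (@moore_coef n).
Proof.
elim: n => [|n IH]; last exact: moore_form_next.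
move=> x _; exists 1; split; first by rewrite mdet_moore0 scale1r.
rewrite expr1n; have e : (\sum_(i < 0) 2 = 0)%N by rewrite big_ord0.
by move: (hat x); rewrite e => A; rewrite det_mx00.
Qed.

(** * Convergence and continuity, coordinate by coordinate *)

Lemma biquat_cvgP (T : Type) (F : set_system T) {FF : Filter F}
    (f : T -> H) (l : H) :
  f t @[t --> F] --> l <->
  [/\ (f t).1.1 @[t --> F] --> l.1.1, (f t).1.2 @[t --> F] --> l.1.2,
      (f t).2.1 @[t --> F] --> l.2.1 & (f t).2.2 @[t --> F] --> l.2.2].
Proof.
split=> [fl|].
  have f1 : (f t).1 @[t --> F] --> l.1 by apply: cvg_comp fl _; exact: cvg_fst.
  have f2 : (f t).2 @[t --> F] --> l.2 by apply: cvg_comp fl _; exact: cvg_snd.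
  split.
  - by apply: cvg_comp f1 _; exact: cvg_fst.
  - by apply: cvg_comp f1 _; exact: cvg_snd.
  - by apply: cvg_comp f2 _; exact: cvg_fst.
  - by apply: cvg_comp f2 _; exact: cvg_snd.
case: l => -[l1 l2] [l3 l4] /= [h1 h2 h3 h4].
have h := cvg_pair (cvg_pair h1 h2) (cvg_pair h3 h4).
have -> : f = fun t => (((f t).1.1, (f t).1.2), ((f t).2.1, (f t).2.2)).
  by apply/funext => t; case: (f t) => -[? ?] [? ?].
by move=> A /h.
Qed.

Lemma complex_cvgD (T : Type) (F : set_system T) {FF : Filter F}
    (f g : T -> C) (a b : C) :
  f t @[t --> F] --> a -> g t @[t --> F] --> b -> (f t + g t) @[t --> F] --> a + b.
Proof. exact: (@cvgD C C^o). Qed.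

Lemma complex_cvgB (T : Type) (F : set_system T) {FF : Filter F}
    (f g : T -> C) (a b : C) :
  f t @[t --> F] --> a -> g t @[t --> F] --> b -> (f t - g t) @[t --> F] --> a - b.
Proof. exact: (@cvgB C C^o). Qed.

Lemma complex_cvgM (T : Type) (F : set_system T) {FF : Filter F}
    (f g : T -> C) (a b : C) :
  f t @[t --> F] --> a -> g t @[t --> F] --> b -> (f t * g t) @[t --> F] --> a * b.
Proof. exact: (@cvgM C). Qed.

Lemma biquat_addE (x y : H) :
  [/\ (x + y).1.1 = x.1.1 + y.1.1 :> C, (x + y).1.2 = x.1.2 + y.1.2 :> C,
      (x + y).2.1 = x.2.1 + y.2.1 :> C & (x + y).2.2 = x.2.2 + y.2.2 :> C].
Proof. by case: x y => [[x1 x2] [x3 x4]] [[y1 y2] [y3 y4]]. Qed.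

Lemma biquat_cvgD (T : Type) (F : set_system T) {FF : Filter F}
    (f g : T -> H) (a b : H) :
  f t @[t --> F] --> a -> g t @[t --> F] --> b -> (f t + g t) @[t --> F] --> a + b.
Proof.
move=> /biquat_cvgP[f1 f2 f3 f4] /biquat_cvgP[g1 g2 g3 g4].
have E x y := biquat_addE x y.
apply/biquat_cvgP; split.
- rewrite (_ : (fun _ => _) = fun t => (f t).1.1 + (g t).1.1 :> C); last first.
    by apply/funext => t; case: (E (f t) (g t)).
  by have [-> _ _ _] := E a b; exact: complex_cvgD.
- rewrite (_ : (fun _ => _) = fun t => (f t).1.2 + (g t).1.2 :> C); last first.
    by apply/funext => t; case: (E (f t) (g t)).
  by have [_ -> _ _] := E a b; exact: complex_cvgD.
- rewrite (_ : (fun _ => _) = fun t => (f t).2.1 + (g t).2.1 :> C); last first.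
    by apply/funext => t; case: (E (f t) (g t)).
  by have [_ _ -> _] := E a b; exact: complex_cvgD.
- rewrite (_ : (fun _ => _) = fun t => (f t).2.2 + (g t).2.2 :> C); last first.
    by apply/funext => t; case: (E (f t) (g t)).
  by have [_ _ _ ->] := E a b; exact: complex_cvgD.
Qed.

(** Each coordinate of a product is bilinear, which reduces limits of products to complex sums and
    products. *)
Lemma biquat_mulE (x y : H) :
  [/\ (x * y).1.1 = x.1.1 * y.1.1 - y.1.2 * x.1.2 - (y.2.1 * x.2.1 + x.2.2 * y.2.2) :> C,
      (x * y).1.2 = x.1.1 * y.1.2 + y.1.1 * x.1.2 - (x.2.1 * y.2.2 - y.2.1 * x.2.2) :> C,
      (x * y).2.1 = x.1.1 * y.2.1 + y.2.2 * x.1.2 + (y.1.1 * x.2.1 - x.2.2 * y.1.2) :> C &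
      (x * y).2.2 = x.1.1 * y.2.2 - y.2.1 * x.1.2 + (y.1.1 * x.2.2 + x.2.1 * y.1.2) :> C].
Proof.
by case: x y => [[x1 x2] [x3 x4]] [[y1 y2] [y3 y4]]; split; rewrite /=; ring.
Qed.

Lemma biquat_cvgM (T : Type) (F : set_system T) {FF : Filter F}
    (f g : T -> H) (a b : H) :
  f t @[t --> F] --> a -> g t @[t --> F] --> b -> (f t * g t) @[t --> F] --> a * b.
Proof.
move=> /biquat_cvgP[f1 f2 f3 f4] /biquat_cvgP[g1 g2 g3 g4].
have E x y := biquat_mulE x y.
apply/biquat_cvgP; split.
- rewrite (_ : (fun _ => _) = fun t => (f t).1.1 * (g t).1.1 - (g t).1.2 * (f t).1.2
      - ((g t).2.1 * (f t).2.1 + (f t).2.2 * (g t).2.2) :> C); last first.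
    by apply/funext => t; case: (E (f t) (g t)).
  have [-> _ _ _] := E a b.
  exact: (complex_cvgB (complex_cvgB (complex_cvgM f1 g1) (complex_cvgM g2 f2))
    (complex_cvgD (complex_cvgM g3 f3) (complex_cvgM f4 g4))).
- rewrite (_ : (fun _ => _) = fun t => (f t).1.1 * (g t).1.2 + (g t).1.1 * (f t).1.2
      - ((f t).2.1 * (g t).2.2 - (g t).2.1 * (f t).2.2) :> C); last first.
    by apply/funext => t; case: (E (f t) (g t)).
  have [_ -> _ _] := E a b.
  exact: (complex_cvgB (complex_cvgD (complex_cvgM f1 g2) (complex_cvgM g1 f2))
    (complex_cvgB (complex_cvgM f3 g4) (complex_cvgM g3 f4))).
- rewrite (_ : (fun _ => _) = fun t => (f t).1.1 * (g t).2.1 + (g t).2.2 * (f t).1.2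
      + ((g t).1.1 * (f t).2.1 - (f t).2.2 * (g t).1.2) :> C); last first.
    by apply/funext => t; case: (E (f t) (g t)).
  have [_ _ -> _] := E a b.
  exact: (complex_cvgD (complex_cvgD (complex_cvgM f1 g3) (complex_cvgM g4 f2))
    (complex_cvgB (complex_cvgM g1 f3) (complex_cvgM f4 g2))).
- rewrite (_ : (fun _ => _) = fun t => (f t).1.1 * (g t).2.2 - (g t).2.1 * (f t).1.2
      + ((g t).1.1 * (f t).2.2 + (f t).2.1 * (g t).1.2) :> C); last first.
    by apply/funext => t; case: (E (f t) (g t)).
  have [_ _ _ ->] := E a b.
  exact: (complex_cvgD (complex_cvgB (complex_cvgM f1 g4) (complex_cvgM g3 f2))
    (complex_cvgD (complex_cvgM g1 f4) (complex_cvgM f3 g2))).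
Qed.

Lemma biquat_continuous_sum (T : topologicalType) (I : Type) (r : seq I)
    (f : I -> T -> H) :
  (forall i, continuous (f i)) -> continuous (fun x => \sum_(i <- r) f i x).
Proof.
move=> cf x; elim: r => [|i r IH]; rewrite /continuous_at.
  under eq_fun do rewrite big_nil; rewrite big_nil; exact: cvg_cst.
under eq_fun do rewrite big_cons; rewrite big_cons.
exact: (biquat_cvgD (@cf i x) IH).
Qed.

Lemma biquat_continuous_prod (T : topologicalType) (I : Type) (r : seq I)
    (f : I -> T -> H) :
  (forall i, continuous (f i)) -> continuous (fun x => \prod_(i <- r) f i x).
Proof.
move=> cf x; elim: r => [|i r IH]; rewrite /continuous_at.
  under eq_fun do rewrite big_nil; rewrite big_nil; exact: cvg_cst.
under eq_fun do rewrite big_cons; rewrite big_cons.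
exact: (biquat_cvgM (@cf i x) IH).
Qed.

Lemma continuous_entry m n (i : 'I_m) (j : 'I_n) :
  continuous (fun x : 'M[H]_(m, n) => x i j).
Proof.
(* A matrix neighbourhood is given by one neighbourhood per entry: [A] at [(i, j)], no constraint
   elsewhere. *)
move=> x A /= nA; exists (fun i' j' => if (i' == i) && (j' == j) then A else setT).
  move=> i' j'; case: ifP => [/andP[/eqP -> /eqP ->]//|_]; exact: filterT.
by move=> y /(_ i j) /=; rewrite !eqxx.
Qed.

(** Both limits persist along the punctured neighbourhoods of 0, where [f] and [g] agree; limits in
    a Hausdorff space are unique. *)
Lemma complex_lim_at0 (f g : C -> C) (a b : C) :
  f t @[t --> nbhs 0] --> a -> g t @[t --> nbhs 0] --> b ->
  (forall t, t != 0 -> f t = g t) -> a = b.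
Proof.
move=> fa gb fg.
have fa' : f t @[t --> (0 : C^o)^'] --> a.
  by apply: cvg_trans fa; apply: cvg_app; exact: cvg_within.
have gb' : g t @[t --> (0 : C^o)^'] --> b.
  by apply: cvg_trans gb; apply: cvg_app; exact: cvg_within.
have fb : f t @[t --> (0 : C^o)^'] --> b.
  apply: cvg_trans gb'; apply: near_eq_cvg.
  near=> t; apply/esym/fg; near: t; exact: nbhs_dnbhs_neq.
exact: (cvg_unique (@norm_hausdorff C C^o) fa' fb).
Unshelve. all: by end_near.
Qed.

Lemma cvg_entries (T : Type) (F : set_system T) {FF : Filter F} m n
    (f : T -> 'M[H]_(m, n)) (l : 'M[H]_(m, n)) :
  (forall i j, f t i j @[t --> F] --> l i j) -> f t @[t --> F] --> l.
Proof.
move=> fl A [P lP PA].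
apply: filterS (PA) _ => /=.
have h i j : \forall t \near F, P i j (f t i j) by exact: fl (lP i j).
by apply: filter_forall => i; apply: filter_forall => j; exact: h.
Qed.

Lemma scalar_cvg (c : C) : (fun t : C => t%:A : H) @ nbhs c --> (c%:A : H).
Proof.
have -> : (fun t : C => t%:A : H) = fun t => ((t, 0), (0, 0)).
  by apply/funext => t; exact: biquat_scalarE.
rewrite biquat_scalarE.
apply/biquat_cvgP; split=> /=; first exact: cvg_id.
all: exact: cvg_cst.
Qed.

Lemma line_cvg m n (x y : 'M[H]_(m, n)) :
  (fun t : C => x + (t%:A : H) *: y) @ nbhs (0 : C) --> x.
Proof.
apply: cvg_entries => i j.
have -> : (fun t : C => (x + (t%:A : H) *: y) i j) =
    (fun t : C => x i j + t%:A * y i j).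
  by apply/funext => t; rewrite !mxE.
have c1 : (fun _ : C => x i j) @ nbhs (0 : C) --> x i j by exact: cvg_cst.
have c2 : (fun _ : C => y i j) @ nbhs (0 : C) --> y i j by exact: cvg_cst.
have c3 := biquat_cvgD c1 (biquat_cvgM (scalar_cvg (c := 0 : C)) c2).
have e : x i j + (0 : C)%:A * y i j = x i j by rewrite scale0r mul0r addr0.
rewrite e in c3.
exact: c3.
Qed.

(** The line stays in [A] and tends to [x] as [t] tends to 0, so continuity within [A] determines
    the values at [x] from those at [t != 0]. *)
Lemma within_continuous_eq_line m n (A : set 'M[H]_(m, n))
    (f g : 'M[H]_(m, n) -> H) (x y : 'M[H]_(m, n)) :
  {within A, continuous f} -> {within A, continuous g} ->
  (forall t : C, A (x + (t%:A : H) *: y)) ->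
  (forall t : C, t != 0 -> f (x + (t%:A : H) *: y) = g (x + (t%:A : H) *: y)) ->
  f x = g x.
Proof.
move=> /subspace_continuousP cf /subspace_continuousP cg Axy fg.
have Ax : A x by have := Axy 0; rewrite scale0r scale0r addr0.
have lim : (fun t : C => x + (t%:A : H) *: y) @ nbhs (0 : C) --> within A (nbhs x).
  move=> P nP; have l0 := line_cvg y (nP : nbhs x (fun z => A z -> P z)).
  pose Q t := P (x + (t%:A : H) *: y).
  have QP : (fun t : C => A (x + (t%:A : H) *: y) -> Q t) `<=` Q by move=> t; apply.
  exact: (filterS QP l0).
have /biquat_cvgP[f1 f2 f3 f4] := cvg_comp _ _ lim (cf x Ax).
have /biquat_cvgP[g1 g2 g3 g4] := cvg_comp _ _ lim (cg x Ax).
apply: bq_eqP.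
- by apply: (complex_lim_at0 f1 g1) => t /fg; exact: (congr1 (fun h : H => h.1.1)).
- by apply: (complex_lim_at0 f2 g2) => t /fg; exact: (congr1 (fun h : H => h.1.2)).
- by apply: (complex_lim_at0 f3 g3) => t /fg; exact: (congr1 (fun h : H => h.2.1)).
- by apply: (complex_lim_at0 f4 g4) => t /fg; exact: (congr1 (fun h : H => h.2.2)).
Qed.

(** * Homogeneity, normalization and the characteristic polynomial *)

Lemma scalar_inj (c d : C) : c%:A = d%:A :> H -> c = d.
Proof. by rewrite !biquat_scalarE => -[]. Qed.

Lemma mdetZ n (a : 'S_n -> 'S_n -> C) (x : 'M[H]_n) (c : C) :
  mdet a ((c%:A : H) *: x) = c ^+ n *: mdet a x.
Proof.
have prodZ m (F : 'I_m -> H) :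
    \prod_(k < m) (c%:A * F k) = c ^+ m *: \prod_(k < m) F k.
  elim: m F => [|m IH] F; first by rewrite !big_ord0 scale1r.
  by rewrite !big_ord_recl IH -scalerAr mulr_algl -scalerAl scalerA -exprSr.
rewrite /mdet scaler_sumr; apply: eq_bigr => s _.
rewrite scaler_sumr; apply: eq_bigr => t _.
rewrite scalerA mulrC -scalerA -prodZ; congr (_ *: _).
by apply: eq_bigr => k _; rewrite mxE.
Qed.

Lemma mdet_continuous n (a : 'S_n -> 'S_n -> C) : continuous (mdet a).
Proof.
apply: biquat_continuous_sum => s; apply: biquat_continuous_sum => t.
have -> : (fun x : 'M[H]_n => a s t *: \prod_(k < n) x (s k) (t k)) =
    (fun x => (a s t)%:A * \prod_(k < n) x (s k) (t k)).
  by apply/funext => x; rewrite mulr_algl.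
move=> x.
have cc : (fun _ : 'M[H]_n => (a s t)%:A : H) @ nbhs x --> ((a s t)%:A : H).
  exact: cvg_cst.
have cp : continuous (fun x : 'M[H]_n => \prod_(k < n) x (s k) (t k)).
  by apply: biquat_continuous_prod => k; exact: continuous_entry.
exact: (biquat_cvgM cc (cp x)).
Qed.

Lemma mdet_moore1 (x : 'M[H]_1) : mdet (@moore_coef 1) x = x 0 0.
Proof.
rewrite mdet_nextE pencil_coef0 mdet_moore0 mulr1.
(* The minor is empty, so the pencil is constant and [P_1 = 0]. *)
by rewrite (leq_sizeP _ _ (size_pencil _ _ _)) ?subr0.
Qed.

Lemma mdet_moore_schur n (x : 'M[H]_n.+1) : Hn R n.+1 x -> x 0 0 != 0 ->
  mdet (@moore_coef n.+1) x = x 0 0 * mdet (@moore_coef n) (schur x).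
Proof. exact/mdet_next_schur/moore_coefP. Qed.

(** The Schur complement of the identity is the identity. This normalization makes the polynomial of
    [char_poly_hat] monic. *)
Lemma mdet_moore_id n : mdet (@moore_coef n) 1%:M = 1.
Proof.
elim: n => [|n IH]; first exact: mdet_moore0.
have h1 : Hn R n.+1 1%:M by have := @Hn_scalar n.+1 1; rewrite scale1r.
have e1 : (1%:M : 'M[H]_n.+1) 0 0 = 1 by rewrite mxE eqxx.
rewrite mdet_moore_schur ?e1 ?oner_neq0 // mul1r -[RHS]IH; congr mdet.
by apply/matrixP => i j; rewrite !mxE /= mulr0 subr0.
Qed.

Lemma hatZ n (x : 'M[H]_n) (c : C) : hat ((c%:A : H) *: x) = c *: hat x.
Proof.
have h0 : hat (0 : 'M[H]_n) = 0.
  by have := @hat_scalar n 0; rewrite scale0r !raddf0.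
by have := hat_line 0 x c; rewrite add0r h0 add0r.
Qed.

Lemma Hn0 n : Hn R n 0.
Proof. by have := @Hn_scalar n 0; rewrite scale0r raddf0. Qed.

Lemma moore_pencil_poly n (x y : 'M[H]_n) : Hn R n x -> Hn R n y ->
  exists p : {poly C}, [/\ (size p <= n.+1)%N,
    forall l : C, mdet (@moore_coef n) ((l%:A : H) *: y + x) = p.[l]%:A,
    mdet (@moore_coef n) y = (p`_n)%:A &
    mdet (@moore_coef n) x = (p`_0)%:A].
Proof.
move=> hx hy.
have [c c0|p pE] := @scalar_valued_poly (pencil (@moore_coef n) x y).
  have [d [dE _]] := moore_coefP (Hn_line c hx hy).
  by exists d; rewrite horner_pencil.
exists p; split.
- by rewrite -(size_map_poly (in_alg H)) -pE size_pencil.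
- by move=> l; rewrite addrC -horner_pencil pE horner_map_alg.
- by rewrite -(pencil_coefn _ x) pE coef_map.
- by rewrite -(pencil_coef0 _ _ y) pE coef_map.
Qed.

Lemma horner_char_poly (F : fieldType) n (A : 'M[F]_n) (l : F) :
  (char_poly A).[l] = \det (l%:M - A).
Proof.
rewrite /char_poly -horner_evalE -det_map_mx; congr (\det _); apply/matrixP => i j.
by rewrite !mxE /= /horner_eval hornerD hornerN hornerC hornerMn hornerX.
Qed.

(** [p] is the form along the line [y + l * 1] with [y = - x]. Its constant term is the value at
    [- x], whence the sign [(-1) ^+ n] by homogeneity. *)
Lemma char_poly_hat n (x : 'M[H]_n) : Hn R n x ->
  exists p : {poly C}, [/\ p \is monic, size p = n.+1, p ^+ 2 = char_poly (hat x) &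
    mdet (@moore_coef n) x = ((-1) ^+ n * p`_0)%:A].
Proof.
move=> hx; pose y := ((-1 : C)%:A : H) *: x.
have h1 : Hn R n 1%:M by have := @Hn_scalar n 1; rewrite scale1r.
have hy : Hn R n y by rewrite -[y]add0r; exact: Hn_line (Hn0 n) hx.
have [p [sp pE pn p0]] := moore_pencil_poly hy h1.
have pn1 : p`_n = 1 by apply: scalar_inj; rewrite -pn mdet_moore_id scale1r.
have sz : size p = n.+1.
  apply/eqP; rewrite eqn_leq sp ltnNge; apply/negP => /leq_sizeP/(_ n (leqnn n)).
  by move/eqP; rewrite pn1 oner_eq0.
exists p; split=> //.
- by rewrite monicE /lead_coef sz pn1.
- apply: poly_eq_nonzero => l _; rewrite horner_char_poly horner_exp.
  have -> : l%:M - hat x = hat (y + (l%:A : H) *: 1%:M).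
    have := @hat_scalar n 1; rewrite scale1r => e1.
    by rewrite hat_line hatZ e1 scalemx1 addrC scaleN1r.
  have [c [cE ->]] := moore_coefP (Hn_line l hy h1).
  by congr (_ ^+ 2); apply: scalar_inj; rewrite -pE addrC cE.
- move: p0; rewrite mdetZ => e.
  rewrite -scalerA -e scalerA -exprD addnn -mul2n exprM sqrrN !expr1n scale1r //.
Qed.

(** * Uniqueness on [Hn], by induction on the size *)

Lemma moore_unique (dt : forall n, 'M[H]_n.+1 -> H) : is_dt dt ->
  forall n (x : 'M[H]_n.+1), Hn R n.+1 x -> dt n x = mdet (@moore_coef n.+1) x.
Proof.
move=> [dtc dt1 dtS]; elim=> [|n IH] x hx; first by rewrite dt1 // mdet_moore1.
have gen z : Hn R n.+2 z -> z 0 0 != 0 -> dt n.+1 z = mdet (@moore_coef n.+2) z.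
  move=> hz z0; rewrite (dtS _ _ hz z0) (mdet_moore_schur hz z0) IH //.
  exact: Hn_schur hz z0.
have [x0|] := eqVneq (x 0 0) 0; last exact: gen.
(* A zero corner entry is perturbed to [t != 0], where the recursion applies; continuity then yields
   the value at [t = 0]. *)
have hxt (t : C) : Hn R n.+2 (x + (t%:A : H) *: delta_mx 0 0).
  exact: Hn_line hx (Hn_delta _).
apply: (within_continuous_eq_line (dtc n.+1) _ hxt) => [|t t0].
  exact/continuous_subspaceT/mdet_continuous.
apply: gen => //; rewrite !mxE x0 add0r eqxx mulr1.
by rewrite scaler_eq0 (negPf t0) oner_eq0.
Qed.

End Biquat.

Theorem theorem5p1 (R : realType) :
  exists dt : forall n : nat, 'M[biquat R]_n.+1 -> biquat R,
    (* (i)-(iii), and uniqueness as mappings on H_n *)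
    is_dt dt /\
    (forall dt' : forall n : nat, 'M[biquat R]_n.+1 -> biquat R, is_dt dt' ->
       forall (n : nat) (x : 'M[biquat R]_n.+1), Hn R n.+1 x ->
         dt' n x = dt n x) /\
    (* (iv) *)
    (forall (n : nat) (x : 'M[biquat R]_n.+1), Hn R n.+1 x ->
       exists c : R[i], dt n x = c%:A) /\
    (* (v) *)
    (forall (n : nat) (x : 'M[biquat R]_n.+1) (a : R[i]), Hn R n.+1 x ->
       dt n ((a%:A : biquat R) *: x) = a ^+ n.+1 *: dt n x) /\
    (* (vi) *)
    (forall n : nat, exists a : 'S_n.+1 -> 'S_n.+1 -> R[i],
       forall x : 'M[biquat R]_n.+1, Hn R n.+1 x ->
         dt n x = \sum_(s : 'S_n.+1) \sum_(t : 'S_n.+1)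
                    a s t *: \prod_(k < n.+1) x (s k) (t k)) /\
    (* (vii) *)
    (forall (n : nat) (x : 'M[biquat R]_n.+1), Hn R n.+1 x ->
       (\det (hat x))%:A = dt n x ^+ 2) /\
    (* (viii) *)
    (forall (n : nat) (x y : 'M[biquat R]_n.+1),
       Hn R n.+1 x -> Hn R n.+1 y ->
       exists p : {poly R[i]},
         [/\ (size p <= n.+2)%N,
             forall l : R[i],
               dt n ((l%:A : biquat R) *: y + x) = p.[l]%:A,
             dt n y = (p`_n.+1)%:A
           & dt n x = (p`_0)%:A]) /\
    (* (ix) *)
    (forall (n : nat) (x : 'M[biquat R]_n.+1), Hn R n.+1 x ->
       (forall a : R[i], eigenvalue (hat x) a ->
          ~~ odd (mup a (char_poly (hat x)))) /\
       exists s : seq R[i],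
         [/\ uniq s,
             forall a : R[i], (a \in s) = eigenvalue (hat x) a
           & dt n x =
             (\prod_(a <- s) a ^+ (mup a (char_poly (hat x)))./2)%:A]).
Proof.
(* [moore_coef] is indexed by the size, [dt] by the size minus one. *)
exists (fun n x => mdet (@moore_coef R n.+1) x).
split; [split|split; [|split; [|split; [|split; [|split; [|split]]]]]].
- by move=> n; exact/continuous_subspaceT/mdet_continuous.
- by move=> x _; exact: mdet_moore1.
- by move=> n x hx x0; exact: mdet_moore_schur.
- by move=> dt' hdt' n x hx; exact: moore_unique.
- by move=> n x /moore_coefP[c [-> _]]; exists c.
- by move=> n x a _; exact: mdetZ.
- by move=> n; exists (@moore_coef R n.+1).
- move=> n x /moore_coefP[c [-> ->]].
  by rewrite [RHS]expr2 mulr_algl scalerA -expr2.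
- by move=> n x y hx hy; exact: moore_pencil_poly.
move=> n x hx; have [p [pm sp pc ->]] := char_poly_hat hx.
(* [r] lists the roots of [p] with multiplicity; squaring [p] doubles each multiplicity, so half of
   it is the count in [r]. *)
have [r] := closed_field_poly_normal p; rewrite (monicP pm) scale1r => pr.
have mupE a : mup a (char_poly (hat x)) = (count_mem a r).*2.
  by rewrite -pc expr2 mupM ?monic_neq0 // pr mu_prod_XsubC addnn.
split=> [a _|]; first by rewrite mupE odd_double.
exists (undup r); split; first exact: undup_uniq.
  move=> a; rewrite mem_undup eigenvalue_root_char -pc expr2 rootM orbb pr.
  by rewrite root_prod_XsubC.
have sr : size r = n.+1 by apply: succn_inj; rewrite -sp pr size_prod_XsubC.
(* The constant term of [p] is [(-1) ^+ n.+1] times the product of its roots, and this sign cancels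
   the one from [char_poly_hat]. *)
rewrite [in LHS]pr coef0_prod_XsubC sr mulrA -exprD addnn -mul2n exprM sqrrN.
rewrite !expr1n mul1r; congr (_ *: _); under [RHS]eq_bigr do rewrite mupE doubleK.
by rewrite prodr_undup_exp_count.
Qed.
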